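(* Let $I\subset\mathbb{Q}\langle G\rangle$ be a fractional $\mathbb{Z}\langle G\rangle$-ideal and $w\in\mathbb{Q}\langle G\rangle$. Suppose that $I\bar I\subset\mathbb{Z}\langle G\rangle\cdot w$ and $\psi(w)\in\mathbb{R}_{>0}$ for all $\psi\in\Psi$. Then: (i) $\bar w=w$; (ii) $w\in\mathbb{Q}\langle G\rangle^\ast$; (iii) $I$ is a $G$-lattice, with $G$-action defined by multiplication in $\mathbb{Q}\langle G\rangle$ and with lattice structure defined by $\langle x,y\rangle_{I,w}=t\!\left(\frac{x\bar y}{w}\right)$.
   Context: Let $G$ be a finite abelian group with a fixed element $u$ of order $2$. For a commutative ring $A$, $A\langle G\rangle=A[G]/(u+1)$. The scaled trace $t:A\langle G\rangle\to A$ is $t(\sum_{\sigma\in G}a_\sigma\sigma)=a_1-a_u$ (well defined), and the involution $a\mapsto\bar a$ on $A\langle G\rangle$ sends $\sum a_\sigma\sigma$ to $\sum a_\sigma\sigma^{-1}$; for a subset $I$, $\bar I=\{\bar a: a\in I\}$ and $I\bar I$ is the $\mathbb{Z}\langle G\rangle$-module generated by products. $\Psi$ denotes the set of ring homomorphisms $\mathbb{Q}\langle G\rangle\to\mathbb{C}$ (equivalently, group homomorphisms $\psi:G\to\mathbb{C}^\ast$ with $\psi(u)=-1$, extended linearly). A fractional $\mathbb{Z}\langle G\rangle$-ideal is a finitely generated $\mathbb{Z}\langle G\rangle$-submodule of $\mathbb{Q}\langle G\rangle$ that spans $\mathbb{Q}\langle G\rangle$ over $\mathbb{Q}$. A lattice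 is a finitely generated abelian group with a bilinear, symmetric, positive definite $\mathbb{Z}$-valued form; a $G$-lattice is a lattice with a homomorphism from $G$ to its group of form-preserving automorphisms such that $u$ acts as $-1$. *)

(* Defs.v *)
From HB Require Import structures.
From mathcomp Require Import all_boot all_order all_fingroup all_algebra.
From mathcomp Require Import boolp classical_sets cardinality reals.
From mathcomp Require Export complex.

Set Implicit Arguments.
Unset Strict Implicit.
Unset Printing Implicit Defensive.

Import GRing.Theory.
Local Open Scope ring_scope.
Local Open Scope quotient_scope.

Record abGroupU := AbGroupU {
  abg_sort :> finGroupType;
  abg_abelian : abelian [set: abg_sort];
  abg_u : abg_sort;
  abg_u_order : #[abg_u]%g = 2%N }.

Section GroupFacts.
Variable G : abGroupU.
Implicit Types g h : G.

Lemma abgC g h : (g * h = h * g)%g.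
Proof. by apply: (centsP (abg_abelian G)); rewrite inE. Qed.

Lemma abg_u_neq1 : abg_u G != 1%g.
Proof. by rewrite -order_eq1 abg_u_order. Qed.

Lemma abg_uu : (abg_u G * abg_u G = 1)%g.
Proof. by rewrite -(expg_order (abg_u G)) abg_u_order expgS expg1. Qed.

Lemma abg_uV : ((abg_u G)^-1 = abg_u G)%g.
Proof. by apply/(mulgI (abg_u G)); rewrite mulgV abg_uu. Qed.

End GroupFacts.

(* The group ring A[G]: functions G -> A under convolution. *)
Definition grpRing (A : comNzRingType) (G : abGroupU) : Type :=
  {ffun G -> A}.

Section GroupRing.
Variables (A : comNzRingType) (G : abGroupU).
Local Notation AG := (grpRing A G).
Implicit Types a b c : AG.
Implicit Types g h : G.

HB.instance Definition _ := GRing.Lmodule.copy AG {ffun G -> A^o}.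

Definition gcoef a g : A := (a : {ffun G -> A}) g.
Definition gelt g : AG := [ffun h => (h == g)%:R] : {ffun G -> A}.
Definition gmul a b : AG :=
  [ffun g => \sum_(h : G) gcoef a h * gcoef b (h^-1 * g)%g] : {ffun G -> A}.

Lemma gcoefP a b : (forall g, gcoef a g = gcoef b g) -> a = b.
Proof. by move=> ab; apply/ffunP. Qed.

Lemma gcoefD a b g : gcoef (a + b) g = gcoef a g + gcoef b g.
Proof. by rewrite /gcoef ffunE. Qed.

Lemma gcoefN a g : gcoef (- a) g = - gcoef a g.
Proof. by rewrite /gcoef ffunE. Qed.

Lemma gcoef0 g : gcoef 0 g = 0.
Proof. by rewrite /gcoef ffunE. Qed.

Lemma gcoefZ k a g : gcoef (k *: a) g = k * gcoef a g.
Proof. by rewrite /gcoef ffunE. Qed.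

Lemma gcoef_elt g h : gcoef (gelt g) h = (h == g)%:R.
Proof. by rewrite /gcoef ffunE. Qed.

Lemma gcoef_gmul a b g :
  gcoef (gmul a b) g = \sum_(h : G) gcoef a h * gcoef b (h^-1 * g)%g.
Proof. by rewrite /gcoef ffunE. Qed.

Lemma gmulC : commutative gmul.
Proof.
move=> a b; apply: gcoefP => g; rewrite !gcoef_gmul.
rewrite (reindex_inj (h := fun h : G => (g * h^-1)%g)) /=; last first.
  by move=> x y /mulgI /invg_inj.
apply: eq_bigr => h _; rewrite mulrC invMg invgK -mulgA mulVg mulg1.
by rewrite abgC.
Qed.

Lemma gmulA : associative gmul.
Proof.
move=> a b c; apply: gcoefP => g; rewrite !gcoef_gmul.
under eq_bigr => h _ do rewrite gcoef_gmul mulr_sumr.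
under [RHS]eq_bigr => h _ do rewrite gcoef_gmul mulr_suml.
rewrite [RHS]exchange_big; apply: eq_bigr => h _ /=.
rewrite [RHS](reindex_inj (mulgI h)) /=; apply: eq_bigr => k _.
by rewrite mulKg mulrA invMg mulgA.
Qed.

Lemma gelt1_mul : left_id (gelt 1%g) gmul.
Proof.
move=> a; apply: gcoefP => g; rewrite gcoef_gmul (bigD1 1%g) //=.
rewrite gcoef_elt eqxx mul1r invg1 mul1g big1 ?addr0 // => h /negPf h1.
by rewrite gcoef_elt h1 mul0r.
Qed.

Lemma gmulDl : left_distributive gmul +%R.
Proof.
move=> a b c; apply: gcoefP => g; rewrite gcoefD !gcoef_gmul -big_split /=.
by apply: eq_bigr => h _; rewrite gcoefD mulrDl.
Qed.

Lemma gelt1_neq0 : gelt 1%g != 0.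
Proof.
apply/eqP => /(congr1 (gcoef^~ 1%g)); rewrite gcoef_elt eqxx gcoef0.
by move/eqP; rewrite oner_eq0.
Qed.

HB.instance Definition _ := GRing.Zmodule_isComNzRing.Build AG
  gmulA gmulC gelt1_mul gmulDl gelt1_neq0.

Lemma gcoefM a b g :
  gcoef (a * b) g = \sum_(h : G) gcoef a h * gcoef b (h^-1 * g)%g.
Proof. exact: gcoef_gmul. Qed.

Lemma gelt1 : gelt 1%g = 1. Proof. by []. Qed.

Lemma gcoefM_elt a g h : gcoef (a * gelt g) h = gcoef a (h * g^-1)%g.
Proof.
rewrite mulrC gcoefM (bigD1 g) //= gcoef_elt eqxx mul1r big1 ?addr0.
  by rewrite abgC.
by move=> k /negPf kg; rewrite gcoef_elt kg mul0r.
Qed.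

Lemma gscaleAl k a b : k *: (a * b) = (k *: a) * b.
Proof.
apply: gcoefP => g; rewrite gcoefZ !gcoefM mulr_sumr.
by apply: eq_bigr => h _; rewrite gcoefZ mulrA.
Qed.

(* The principal ideal (u + 1) of A[G]. *)
Definition uideal (a : AG) : bool :=
  `[< exists b, a = b * (gelt (abg_u G) + 1) >].

Lemma gcoefM_u1 b g :
  gcoef (b * (gelt (abg_u G) + 1)) g = gcoef b (g * abg_u G)%g + gcoef b g.
Proof. by rewrite mulrDr mulr1 gcoefD gcoefM_elt abg_uV. Qed.

Lemma uideal_closed : idealr_closed uideal.
Proof.
split=> [||c].
- by apply/asboolP; exists 0; rewrite mul0r.
- apply/negP => /asboolP [b e].
  have e1 := congr1 (gcoef^~ 1%g) e; have eu := congr1 (gcoef^~ (abg_u G)) e.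
  move: e1 eu; rewrite /= !gcoefM_u1 -gelt1 !gcoef_elt eqxx mul1g.
  rewrite (negPf (abg_u_neq1 G)) abg_uu addrC => <- /eqP.
  by rewrite eq_sym oner_eq0.
move=> x y /asboolP [bx ->] /asboolP [y' ->]; apply/asboolP.
by exists (c * bx + y'); rewrite mulrDl mulrA.
Qed.

HB.instance Definition _ := isIdealr.Build AG uideal uideal_closed.

End GroupRing.

(* A<G> = A[G]/(u + 1). *)
Definition twRing (A : comNzRingType) (G : abGroupU) : Type :=
  {ideal_quot (@uideal A G : idealr (grpRing A G))}.

Section TwistedGroupRing.
Variables (A : comNzRingType) (G : abGroupU).
Local Notation AG := (grpRing A G).
Local Notation TG := (twRing A G).
Implicit Types a b : AG.
Implicit Types x y : TG.

HB.instance Definition _ := GRing.ComNzRing.on TG.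
HB.instance Definition _ := NzRingQuotient.on TG.

Definition tpi : AG -> TG := \pi.
Definition trepr : TG -> AG := generic_quotient.repr.

Lemma treprK : cancel trepr tpi.
Proof. exact: generic_quotient.reprK. Qed.

Lemma tpi_is_zmod_morphism : zmod_morphism tpi.
Proof. exact: (rmorphB (\pi_TG)). Qed.

Lemma tpi_is_monoid_morphism : monoid_morphism tpi.
Proof. by split; [exact: (rmorph1 (\pi_TG)) | exact: (rmorphM (\pi_TG))]. Qed.

HB.instance Definition _ :=
  GRing.isZmodMorphism.Build AG TG tpi tpi_is_zmod_morphism.
HB.instance Definition _ :=
  GRing.isMonoidMorphism.Build AG TG tpi tpi_is_monoid_morphism.

Lemma tpi_eq a b :
  tpi a = tpi b <-> exists c, a - b = c * (gelt A (abg_u G) + 1).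
Proof.
have e : (tpi a == tpi b) = (a - b \in @uideal A G).
  by rewrite Quotient.idealrBE.
by split=> [/eqP|h]; [rewrite e => /asboolP | apply/eqP; rewrite e; apply/asboolP].
Qed.

Lemma trepr_tpi a :
  exists c, trepr (tpi a) = a + c * (gelt A (abg_u G) + 1).
Proof.
have /tpi_eq [c hc] : tpi (trepr (tpi a)) = tpi a by rewrite treprK.
by exists c; rewrite -hc addrCA subrr addr0.
Qed.

(* A[G] -> A<G> is A-linear; the scalar action on A<G> is the induced one. *)
Definition tscale (k : A) x : TG := tpi (k *: (1 : AG)) * x.

Lemma tscaleA k l x : tscale k (tscale l x) = tscale (k * l) x.
Proof. by rewrite /tscale mulrA -rmorphM -gscaleAl mul1r scalerA. Qed.
Lemma tscale1 : left_id 1 tscale.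
Proof. by move=> x; rewrite /tscale scale1r rmorph1 mul1r. Qed.
Lemma tscaleDr : right_distributive tscale +%R.
Proof. by move=> k x y; rewrite /tscale mulrDr. Qed.
Lemma tscaleDl x : {morph tscale^~ x : k l / k + l}.
Proof. by move=> k l; rewrite /tscale scalerDl rmorphD mulrDl. Qed.

HB.instance Definition _ :=
  GRing.Zmodule_isLmodule.Build A TG tscaleA tscale1 tscaleDr tscaleDl.

Lemma tpiZ k a : tpi (k *: a) = k *: tpi a.
Proof. by rewrite [RHS]/(tscale _ _) /tscale -rmorphM -gscaleAl mul1r. Qed.

Definition tunit : {pred TG} := fun x => `[< exists y, y * x = 1 >].
Definition tinv x : TG :=
  if pselect (exists y, y * x = 1) is left h then projT1 (cid h) else x.

Lemma tmulVx : {in tunit, left_inverse 1 tinv *%R}.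
Proof.
move=> x /asboolP h; rewrite /tinv; case: pselect => // h'.
by case: cid.
Qed.
Lemma tunitP x y : y * x = 1 -> x \in tunit.
Proof. by move=> e; apply/asboolP; exists y. Qed.
Lemma tinv_out : {in [predC tunit], tinv =1 id}.
Proof.
move=> x /negP h; rewrite /tinv; case: pselect => // h'.
by case: h; apply/asboolP.
Qed.

HB.instance Definition _ :=
  GRing.ComNzRing_hasMulInverse.Build TG tmulVx tunitP tinv_out.

Definition telt (g : G) : TG := tpi (gelt A g).

(* The scaled trace; [ttrace_tpi] shows that it does not depend on the
   representative. *)
Definition ttrace x : A :=
  gcoef (trepr x) 1%g - gcoef (trepr x) (abg_u G).

Lemma ttrace_tpi a : ttrace (tpi a) = gcoef a 1%g - gcoef a (abg_u G).
Proof.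
rewrite /ttrace; have [c ->] := trepr_tpi a.
rewrite !gcoefD !gcoefM_u1 mul1g abg_uu [gcoef c 1%g + _]addrC.
by rewrite opprD addrACA subrr addr0.
Qed.

Definition gbar a : AG := [ffun g => gcoef a g^-1%g] : {ffun G -> A}.

Lemma gcoef_bar a g : gcoef (gbar a) g = gcoef a g^-1%g.
Proof. by rewrite /gcoef ffunE. Qed.

Definition tbar x : TG := tpi (gbar (trepr x)).

Lemma tbar_tpi a : tbar (tpi a) = tpi (gbar a).
Proof.
rewrite /tbar; have [c ->] := trepr_tpi a.
apply/tpi_eq; exists (gbar c); apply: gcoefP => g.
rewrite gcoefD gcoefN !gcoef_bar gcoefD !gcoefM_u1 !gcoef_bar.
by rewrite addrAC subrr add0r invMg abg_uV abgC.
Qed.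

End TwistedGroupRing.

Section BaseChange.
Variables (A B : comNzRingType) (f : {rmorphism A -> B}) (G : abGroupU).

Definition gmap (a : grpRing A G) : grpRing B G :=
  [ffun g => f (gcoef a g)] : {ffun G -> B}.

Definition tmap (x : twRing A G) : twRing B G := tpi (gmap (trepr x)).

Lemma gcoef_map a g : gcoef (gmap a) g = f (gcoef a g).
Proof. by rewrite /gcoef ffunE. Qed.

Lemma gmapB : {morph gmap : a b / a - b}.
Proof.
by move=> a b; apply: gcoefP => g; rewrite !(gcoefD, gcoefN, gcoef_map) rmorphB.
Qed.

Lemma gmap_elt g : gmap (gelt A g) = gelt B g.
Proof.
by apply: gcoefP => h; rewrite gcoef_map !gcoef_elt rmorph_nat.
Qed.

Lemma gmapM : {morph gmap : a b / a * b}.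
Proof.
move=> a b; apply: gcoefP => g; rewrite gcoef_map !gcoefM rmorph_sum.
by apply: eq_bigr => h _; rewrite rmorphM !gcoef_map.
Qed.

Lemma gmapD : {morph gmap : a b / a + b}.
Proof.
by move=> a b; apply: gcoefP => g; rewrite !(gcoefD, gcoef_map) rmorphD.
Qed.

Lemma tmap_tpi a : tmap (tpi a) = tpi (gmap a).
Proof.
rewrite /tmap; have [c ->] := trepr_tpi a; apply/tpi_eq; exists (gmap c).
by rewrite gmapD addrAC subrr add0r gmapM gmapD gmap_elt -gelt1 gmap_elt.
Qed.

Lemma tmap_is_zmod_morphism : zmod_morphism tmap.
Proof.
move=> x y; rewrite -[x]treprK -[y]treprK -rmorphB !tmap_tpi.
by rewrite gmapB rmorphB.
Qed.

Lemma tmap_is_monoid_morphism : monoid_morphism tmap.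
Proof.
split=> [|x y].
  by rewrite -(rmorph1 (@tpi A G)) tmap_tpi gmap_elt (rmorph1 (@tpi B G)).
by rewrite -[x]treprK -[y]treprK -rmorphM !tmap_tpi gmapM rmorphM.
Qed.

HB.instance Definition _ :=
  GRing.isZmodMorphism.Build (twRing A G) (twRing B G) tmap
    tmap_is_zmod_morphism.
HB.instance Definition _ :=
  GRing.isMonoidMorphism.Build (twRing A G) (twRing B G) tmap
    tmap_is_monoid_morphism.

End BaseChange.

Notation ZG := (twRing int).
Notation QG := (twRing rat).

Definition ZGtoQG (G : abGroupU) : {rmorphism ZG G -> QG G} :=
  @tmap int rat intr G.

Local Open Scope classical_set_scope.

(* The submodule generated by S, for scalars K acting on V through act. *)
Definition gen_by (K : Type) (V : nmodType) (act : K -> V -> V) (S : set V) :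
    set V :=
  [set x | exists n (c : 'I_n -> K) (s : 'I_n -> V),
     (forall i, S (s i)) /\ x = \sum_i act (c i) (s i)].

Definition fin_gen (K : Type) (V : nmodType) (act : K -> V -> V) (M : set V) :=
  exists2 S : set V, finite_set S & M = gen_by act S.

Definition ZGact (G : abGroupU) (a : ZG G) (x : QG G) : QG G := ZGtoQG G a * x.

Record fracIdeal (G : abGroupU) := FracIdeal {
  fi_set :> set (QG G);
  fi_0 : fi_set 0;
  fi_add : forall x y, fi_set x -> fi_set y -> fi_set (x + y);
  fi_act : forall a x, fi_set x -> fi_set (ZGact a x);
  fi_fin_gen : fin_gen (@ZGact G) fi_set;
  fi_span : gen_by (fun (q : rat) (x : QG G) => q *: x) fi_set = [set: QG G] }.

(* The subset I of Q<G>, as an abelian group. *)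
Definition fiType (G : abGroupU) (I : fracIdeal G) : Type :=
  {x : QG G | x \in fi_set I}.

Section FracIdealGroup.
Variables (G : abGroupU) (I : fracIdeal G).

Definition fi_pred : {pred QG G} := fun x => x \in fi_set I.

Lemma fi_zmod_closed : zmod_closed fi_pred.
Proof.
split=> [|x y /set_mem xI /set_mem yI]; apply/mem_set; first exact: fi_0.
apply: fi_add => //; have := @fi_act G I (-1) y yI.
by rewrite /ZGact rmorphN1 mulN1r.
Qed.

HB.instance Definition _ := GRing.isZmodClosed.Build (QG G) fi_pred
  fi_zmod_closed.
HB.instance Definition _ := SubChoice.copy (fiType I) {x : QG G | fi_pred x}.
HB.instance Definition _ := [SubChoice_isSubZmodule of fiType I by <:].

Definition fi_val (x : fiType I) : QG G := val x.

End FracIdealGroup.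

Definition bar_set (G : abGroupU) (I : set (QG G)) : set (QG G) :=
  [set tbar x | x in I].

Definition prod_module (G : abGroupU) (I J : set (QG G)) : set (QG G) :=
  gen_by (@ZGact G) [set z | exists x y, [/\ I x, J y & z = x * y]].

Definition principal_module (G : abGroupU) (w : QG G) : set (QG G) :=
  [set ZGact a w | a in [set: ZG G]].

Record is_lattice (L : zmodType) (form : L -> L -> int) : Prop := IsLattice {
  lat_fin_gen : fin_gen (fun (k : int) (x : L) => x *~ k) [set: L];
  lat_addl : forall x y z, form (x + y) z = form x z + form y z;
  lat_addr : forall x y z, form x (y + z) = form x y + form x z;
  lat_sym : forall x y, form x y = form y x;
  lat_posdef : forall x, x != 0 -> (0 < form x x)%R }.

Record is_lattice_aut (L : zmodType) (form : L -> L -> int) (f : L -> L) :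
    Prop := IsLatticeAut {
  aut_add : {morph f : x y / x + y};
  aut_bij : bijective f;
  aut_form : forall x y, form (f x) (f y) = form x y }.

Record is_Glattice (G : abGroupU) (L : zmodType) (form : L -> L -> int)
    (act : G -> L -> L) : Prop := IsGlattice {
  Glat_lattice : is_lattice form;
  Glat_aut : forall g, is_lattice_aut form (act g);
  Glat_mul : forall g h x, act (g * h)%g x = act g (act h x);
  Glat_u : forall x, act (abg_u G) x = - x }.

Definition form_Iw (G : abGroupU) (w x y : QG G) : rat :=
  ttrace (x * tbar y / w).

(* Main.v *)
(** The characters [chi] of [G] with values in [C] diagonalise the regular
    representation, and those with [chi u = -1] give homomorphisms [psi] from
    [Q<G>] to [C] satisfying [psi (bar x) = conj (psi x)]. Comparing traces,
    [#|G| t(x)] is twice the sum of the [psi x]; since [t] is nondegenerate,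
    the [psi] are jointly injective. So [w] and [bar w], having the same real
    images, are equal; [w] is a unit because the determinant of multiplication
    by [w] is a product of the nonzero [psi w]; and [#|G| <x, x>] is twice the
    sum of the [|psi x|^2 / psi w], which is positive for [x <> 0].
    Integrality comes from [x (bar y) / w] lying in [Z<G>], and the translates
    by [G] of generators of [I] over [Z<G>] generate it over [Z]. *)

Require Import Defs.
From HB Require Import structures.
From mathcomp Require Import all_boot all_order all_fingroup all_algebra.
From mathcomp Require Import separable cyclotomic.
From mathcomp Require Import boolp classical_sets cardinality reals.

Import Order.TTheory GRing.Theory Num.Theory.
Local Open Scope ring_scope.
Local Open Scope classical_set_scope.

(** * Diagonalisation of matrices of finite order *)

(** The minimal polynomial divides [X^k - 1], which splits over [C] and is separable in
    characteristic 0. *)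
Lemma diagonalizable_root_of_unity (C : numClosedFieldType) n (A : 'M[C]_n) k :
  (0 < k)%N -> A ^+ k = 1 -> diagonalizable A.
Proof.
case: n A => [|n] A k_gt0 Ak.
  by rewrite [A]flatmx0; exact: diagonalizable0.
apply/diagonalizableP.
have [r Dr] := closed_field_poly_normal ('X^k - 1 : {poly C}).
rewrite lead_coefXnsubC // scale1r in Dr.
exists r; last first.
  apply: mxminpoly_min; rewrite -Dr rmorphB rmorphXn rmorph1 /= horner_mx_X.
  by rewrite Ak subrr.
by rewrite -separable_prod_XsubC -Dr separable_Xn_sub_1 // pnatr_eq0 -lt0n.
Qed.

(** * The regular representation of [A[G]] *)

Section RegularMatrix.
Variables (A : comNzRingType) (G : abGroupU).
Implicit Types a b : grpRing A G.

(** Row [i] holds the coefficients of [enum_val i] times [a], so on row vectors this is right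
    multiplication by [a]. *)
Definition regular_mx a : 'M[A]_#|G| :=
  \matrix_(i, j) gcoef a ((enum_val i)^-1 * enum_val j)%g.

Lemma regular_mxM : {morph regular_mx : a b / a * b >-> a *m b}.
Proof.
move=> a b; apply/matrixP => i j; rewrite !mxE gcoefM.
rewrite (reindex_inj (mulgI (enum_val i)^-1%g)) /=.
rewrite (reindex (fun k : 'I_#|G| => enum_val k)) /=; last first.
  by exists enum_rank => g _; rewrite ?enum_valK ?enum_rankK.
by apply: eq_bigr => k _; rewrite !mxE invMg invgK -mulgA mulKVg.
Qed.

Lemma regular_mx1 : regular_mx 1 = 1%:M.
Proof.
apply/matrixP => i j; rewrite !mxE -gelt1 gcoef_elt.
by rewrite -eq_mulVg1 (inj_eq enum_val_inj).
Qed.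

Lemma regular_mxtrace a : \tr (regular_mx a) = gcoef a 1%g *+ #|G|.
Proof.
rewrite /mxtrace (eq_bigr (fun=> gcoef a 1%g)) ?sumr_const ?card_ord //.
by move=> i _; rewrite mxE mulVg.
Qed.

Lemma geltM (g h : G) : gelt A (g * h)%g = gelt A g * gelt A h.
Proof.
apply: gcoefP => k; rewrite gcoefM_elt !gcoef_elt.
by rewrite -(inj_eq (mulIg h^-1%g)) mulgK.
Qed.

Lemma grpRing_sum a : a = \sum_g gcoef a g *: gelt A g.
Proof.
have coef_sum (F : G -> grpRing A G) k :
    gcoef (\sum_g F g) k = \sum_g gcoef (F g) k.
  by elim/big_rec2: _ => [|g _ x _ <-]; rewrite ?gcoef0 ?gcoefD.
apply: gcoefP => k; rewrite coef_sum (bigD1 k) //= gcoefZ gcoef_elt eqxx mulr1.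
rewrite big1 ?addr0 // => g /negPf gk.
by rewrite gcoefZ gcoef_elt eq_sym gk mulr0.
Qed.

End RegularMatrix.

Arguments regular_mx {A G}.

(** * Characters of [G] and their linear extension to [Q[G]] *)

Record gchar (C : numClosedFieldType) (G : abGroupU) := GChar {
  gchar_fun :> G -> C;
  gchar1 : gchar_fun 1%g = 1;
  gcharM : {morph gchar_fun : g h / (g * h)%g >-> g * h} }.

Arguments gchar1 {C G}.
Arguments gcharM {C G}.

Section Characters.
Variables (C : numClosedFieldType) (G : abGroupU).
Implicit Types (chi : gchar C G) (a b : grpRing rat G).

Lemma gchar_neq0 chi g : chi g != 0.
Proof.
apply/eqP => chig0; have := gcharM chi g g^-1%g.
by rewrite mulgV chig0 mul0r gchar1 => /eqP; rewrite oner_eq0.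
Qed.

Lemma gcharV chi g : chi g^-1%g = (chi g)^-1.
Proof.
apply: (mulfI (gchar_neq0 chi g)).
by rewrite -gcharM mulgV gchar1 mulfV ?gchar_neq0.
Qed.

Lemma gcharX chi g n : chi (g ^+ n)%g = chi g ^+ n.
Proof.
by elim: n => [|n IHn]; rewrite ?gchar1 // expgS gcharM IHn exprS.
Qed.

(** Values of a character are roots of unity, hence of modulus 1, so conjugation inverts them. *)
Lemma gchar_conj chi g : (chi g)^* = chi g^-1%g.
Proof.
have norm1 : `|chi g| = 1.
  apply/eqP; rewrite -(@pexpr_eq1 _ _ #[g]%g) ?order_gt0 //.
  by rewrite -normrX -gcharX expg_order gchar1 normr1.
apply: (mulfI (gchar_neq0 chi g)).
by rewrite -normCK norm1 expr1n gcharV mulfV ?gchar_neq0.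
Qed.

Lemma gchar_u chi : (chi (abg_u G) == 1) || (chi (abg_u G) == -1).
Proof. by rewrite -sqrf_eq1 expr2 -gcharM abg_uu gchar1. Qed.

Definition geval chi a : C := \sum_g ratr (gcoef a g) * chi g.

Lemma gevalD chi : {morph geval chi : a b / a + b}.
Proof.
move=> a b; rewrite -big_split; apply: eq_bigr => g _ /=.
by rewrite gcoefD rmorphD mulrDl.
Qed.

Lemma gevalN chi : {morph geval chi : a / - a}.
Proof.
move=> a; rewrite -sumrN; apply: eq_bigr => g _.
by rewrite gcoefN rmorphN mulNr.
Qed.

Lemma geval_elt chi g : geval chi (gelt rat g) = chi g.
Proof.
rewrite /geval (bigD1 g) //= gcoef_elt eqxx rmorph1 mul1r big1 ?addr0 //.
by move=> h /negPf hg; rewrite gcoef_elt hg rmorph0 mul0r.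
Qed.

Lemma geval1 chi : geval chi 1 = 1.
Proof. by rewrite -gelt1 geval_elt gchar1. Qed.

Lemma gevalM chi : {morph geval chi : a b / a * b}.
Proof.
move=> a b; rewrite /geval big_distrlr /=.
under eq_bigr => g _ do rewrite gcoefM rmorph_sum mulr_suml.
rewrite exchange_big; apply: eq_bigr => h _ /=.
rewrite (reindex_inj (mulgI h)) /=; apply: eq_bigr => k _.
by rewrite mulKg rmorphM gcharM mulrACA.
Qed.

Lemma geval_bar chi a : geval chi (gbar a) = (geval chi a)^*.
Proof.
rewrite /geval rmorph_sum (reindex_inj invg_inj) /=; apply: eq_bigr => g _.
rewrite gcoef_bar invgK rmorphM /= -gchar_conj; congr (_ * _).
by rewrite fmorph_rat.
Qed.

(** The matrices of the elements of [G] commute and have finite order, so a single [P] diagonalises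
    them all. The [i]-th diagonal entry, as a function of [g], is multiplicative and gives
    [chi i]. *)
Lemma regular_mx_diag : exists (P : 'M[C]_#|G|) (chi : 'I_#|G| -> gchar C G),
  P \in unitmx /\ forall a, P *m map_mx ratr (regular_mx a)
    = diag_mx (\row_i geval (chi i) a) *m P.
Proof.
pose M (g : G) := regular_mx (gelt C g).
have MM g h : M (g * h)%g = M g *m M h by rewrite /M geltM regular_mxM.
have MX g k : M (g ^+ k)%g = M g ^+ k.
  elim: k => [|k IHk]; first by rewrite /M gelt1 regular_mx1.
  by rewrite expgS MM IHk exprS.
have [P Pu /allP PD] : codiagonalizable [seq M g | g <- enum G].
  apply/codiagonalizableP; split.
    move=> _ _ /mapP[g _ ->] /mapP[h _ ->].
    by rewrite /comm_mx -!MM abgC.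
  move=> _ /mapP[g _ ->].
  apply: (@diagonalizable_root_of_unity _ _ _ #[g]%g) => //.
  by rewrite -MX expg_order /M gelt1 regular_mx1.
have {PD} /choice[D PD] g : exists d, P *m M g = diag_mx d *m P.
  have /PD/diagonalizable_forPex[d /(simmxP Pu) eqd] :
    M g \in [seq M g | g <- enum G] by apply/map_f; rewrite mem_enum.
  by exists d.
have injD (d d' : 'rV[C]_#|G|) : diag_mx d *m P = diag_mx d' *m P -> d = d'.
  move=> /(congr1 (mulmx^~ (invmx P))); rewrite !mulmxK // => /matrixP eqd.
  by apply/rowP => i; have := eqd i i; rewrite !mxE eqxx !mulr1n.
have D1 i : D 1%g 0 i = 1.
  suff -> : D 1%g = const_mx 1 by rewrite mxE.
  by apply: injD; rewrite -PD /M gelt1 regular_mx1 mulmx1 diag_const_mx mul1mx.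
have DM i : {morph (fun g => D g 0 i) : g h / (g * h)%g >-> g * h}.
  move=> g h; suff -> : D (g * h)%g = \row_j (D g 0 j * D h 0 j) by rewrite mxE.
  apply: injD; rewrite -PD MM mulmxA PD -mulmxA PD mulmxA.
  by rewrite mulmx_diag.
exists P, (fun i => GChar _ _ _ (D1 i) (DM i)); split=> // a.
(* Linearity extends the diagonalisation from [G] to [Q[G]]. *)
have -> : map_mx ratr (regular_mx a) = \sum_g ratr (gcoef a g) *: M g.
  apply/matrixP => i j; rewrite !mxE summxE.
  rewrite (bigD1 ((enum_val i)^-1 * enum_val j)%g) //=.
  rewrite !mxE gcoef_elt eqxx mulr1.
  rewrite big1 ?addr0 // => g /negPf gk.
  by rewrite !mxE gcoef_elt eq_sym gk mulr0.
rewrite mulmx_sumr.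
under eq_bigr => g _ do rewrite -scalemxAr PD scalemxAl -linearZ /=.
rewrite -mulmx_suml -linear_sum; congr (diag_mx _ *m _).
by apply/rowP => i; rewrite summxE !mxE; apply: eq_bigr => g _; rewrite !mxE.
Qed.

End Characters.

Arguments geval {C G}.

(** * Involution and trace on [A<G>] *)

Section TwistedElements.
Variables (A : comNzRingType) (G : abGroupU).
Implicit Types x y : twRing A G.

Lemma telt1 : telt A (1%g : G) = 1.
Proof. by rewrite /telt gelt1 rmorph1. Qed.

Lemma teltM (g h : G) : telt A (g * h)%g = telt A g * telt A h.
Proof. by rewrite /telt geltM rmorphM. Qed.

Lemma telt_u : telt A (abg_u G) = -1.
Proof.
rewrite -(rmorphN1 (@tpi A G)); apply/tpi_eq; exists 1.
by rewrite opprK mul1r.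
Qed.

Lemma gbarM : {morph @gbar A G : a b / a * b}.
Proof.
move=> a b; apply: gcoefP => g; rewrite gcoef_bar !gcoefM.
rewrite (reindex_inj invg_inj) /=; apply: eq_bigr => h _.
by rewrite !gcoef_bar invgK invMg invgK (abgC h).
Qed.

Lemma tbar_is_zmod_morphism : zmod_morphism (@tbar A G).
Proof.
move=> x y; rewrite -[x]treprK -[y]treprK -rmorphB !tbar_tpi -rmorphB.
by congr tpi; apply: gcoefP => g; rewrite !(gcoef_bar, gcoefD, gcoefN).
Qed.

Lemma gbar_elt (g : G) : gbar (gelt A g) = gelt A g^-1%g.
Proof.
by apply: gcoefP => h; rewrite gcoef_bar !gcoef_elt (can2_eq invgK invgK).
Qed.

Lemma tbar_telt (g : G) : tbar (telt A g) = telt A g^-1%g.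
Proof. by rewrite tbar_tpi gbar_elt. Qed.

Lemma tbar_is_monoid_morphism : monoid_morphism (@tbar A G).
Proof.
split=> [|x y]; first by rewrite -telt1 tbar_telt invg1.
by rewrite -[x]treprK -[y]treprK -rmorphM !tbar_tpi gbarM rmorphM.
Qed.

HB.instance Definition _ := GRing.isZmodMorphism.Build
  (twRing A G) (twRing A G) (@tbar A G) tbar_is_zmod_morphism.
HB.instance Definition _ := GRing.isMonoidMorphism.Build
  (twRing A G) (twRing A G) (@tbar A G) tbar_is_monoid_morphism.

Lemma tbarK : involutive (@tbar A G).
Proof.
move=> x; rewrite -[x]treprK !tbar_tpi; congr tpi.
by apply: gcoefP => g; rewrite !gcoef_bar invgK.
Qed.

Lemma ttrace_tbar x : ttrace (tbar x) = ttrace x.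
Proof.
by rewrite -[x]treprK tbar_tpi !ttrace_tpi !gcoef_bar invg1 abg_uV.
Qed.

Lemma ttraceD : {morph @ttrace A G : x y / x + y}.
Proof.
move=> x y; rewrite -[x]treprK -[y]treprK -rmorphD !ttrace_tpi !gcoefD.
by rewrite opprD addrACA.
Qed.

End TwistedElements.

Lemma telt_span (G : abGroupU) (x : ZG G) :
  exists c : G -> int, x = \sum_g telt int g *~ c g.
Proof.
exists (gcoef (trepr x)); rewrite -{1}[x]treprK {1}[trepr x]grpRing_sum.
rewrite rmorph_sum; apply: eq_bigr => g _.
by rewrite -[X in X *: _]intz scaler_int rmorphMz.
Qed.

Lemma ZGtoQG_telt (G : abGroupU) (g : G) : ZGtoQG G (telt int g) = telt rat g.
Proof. by rewrite /= tmap_tpi gmap_elt. Qed.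

Lemma ttrace_ZGtoQG (G : abGroupU) (x : ZG G) :
  ttrace (ZGtoQG G x) = (ttrace x)%:~R.
Proof.
by rewrite -[x]treprK /= tmap_tpi !ttrace_tpi !gcoef_map rmorphB.
Qed.

Lemma ttrace_nondegenerate (G : abGroupU) (x : QG G) :
  (forall g, ttrace (x * telt rat g) = 0) -> x = 0.
Proof.
rewrite -[x]treprK; set a := trepr x => tr0.
(* Vanishing of [t(x g^-1)] says that [a] takes equal values at [g] and [g u], so [a] is [a/2] times
   [u + 1]. *)
rewrite -(rmorph0 (@tpi rat G)); apply/tpi_eq; exists (2^-1 *: a).
apply: gcoefP => g; rewrite subr0 gcoefM_u1 !gcoefZ.
have := tr0 g^-1%g; rewrite -rmorphM ttrace_tpi !gcoefM_elt invgK mul1g.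
move/eqP; rewrite subr_eq0 abgC => /eqP <-.
by rewrite -mulrDr -mulr2n -(mulr_natl (gcoef a g)) mulKf.
Qed.

(** * Characters with [chi u = -1] *)

Section OddCharacters.
Variables (C : numClosedFieldType) (G : abGroupU).

(** [geval chi] kills [u + 1], so it factors through [Q<G>]. *)
Lemma odd_gchar_rmorphism (chi : gchar C G) : chi (abg_u G) = -1 ->
  exists psi : {rmorphism QG G -> C}, forall a, psi (tpi a) = geval chi a.
Proof.
move=> chiu; pose f (x : QG G) := geval chi (trepr x).
have fE a : f (tpi a) = geval chi a.
  rewrite /f; have [c ->] := trepr_tpi a.
  by rewrite gevalD gevalM gevalD geval_elt geval1 chiu addNr mulr0 addr0.
have fB : zmod_morphism f.
  move=> x y; rewrite -[x]treprK -[y]treprK -rmorphB !fE.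
  by rewrite gevalD gevalN.
have fM : monoid_morphism f.
  split=> [|x y]; first by rewrite -(rmorph1 (@tpi rat G)) fE geval1.
  by rewrite -[x]treprK -[y]treprK -rmorphM !fE gevalM.
(* These structures depend on [chiu], so they are packed locally. *)
pose fb := GRing.isZmodMorphism.Build _ _ f fB.
pose fm := GRing.isMonoidMorphism.Build _ _ f fM.
by exists (HB.pack f fb fm : {rmorphism QG G -> C}).
Qed.

(* The trace of [a (1 - u)] in the regular representation is [#|G| t(a)], and
   on this element the characters with [chi u = 1] vanish, while the others
   take the value [2 chi a]. *)
Lemma odd_characters :
  exists (J : finType) (psi : J -> {rmorphism QG G -> C}),
  [/\ forall j x, psi j (tbar x) = (psi j x)^*,
      forall x, ratr (ttrace x) *+ #|G| = (\sum_j psi j x) *+ 2 &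
      forall x, (forall j, psi j x != 0) -> x \is a GRing.unit].
Proof.
have [P [chi [Pu Pdiag]]] := regular_mx_diag C G.
pose oddi : {pred 'I_#|G|} := [pred i | chi i (abg_u G) == -1].
(* Indices rather than characters: sums over [J] count multiplicities. *)
pose J := {i in oddi}.
have /choice[psi psiE] (j : J) : exists psi : {rmorphism QG G -> C},
    forall a, psi (tpi a) = geval (chi (val j)) a.
  by apply: odd_gchar_rmorphism; exact/eqP/(valP j).
pose u := gelt rat (abg_u G).
have diagE a : map_mx ratr (regular_mx a)
    = invmx P *m (diag_mx (\row_i geval (chi i) a) *m P).
  by rewrite -Pdiag mulKmx.
exists J, psi; split=> [j x|x|x psix].
- by rewrite -[x]treprK tbar_tpi !psiE geval_bar.
- rewrite -[x]treprK ttrace_tpi; set a := trepr x.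
  have -> : gcoef a 1%g - gcoef a (abg_u G) = gcoef (a * (1 - u)) 1%g.
    by rewrite mulrBr mulr1 gcoefD gcoefN gcoefM_elt abg_uV mul1g.
  rewrite -rmorphMn -regular_mxtrace -trace_map_mx diagE mxtrace_mulC mulmxK //.
  rewrite mxtrace_diag (bigID (mem oddi)) /=.
  rewrite [X in _ + X]big1 ?addr0; last first.
    move=> i /negPf; rewrite inE => ui.
    have := gchar_u _ _ (chi i); rewrite ui orbF => /eqP u1.
    by rewrite mxE gevalM gevalD gevalN geval1 geval_elt u1 subrr mulr0.
  rewrite -sumrMnl (big_sub oddi).
  apply: eq_bigr => j _; rewrite psiE mxE gevalM gevalD gevalN geval1 geval_elt.
  by rewrite (eqP (valP j)) opprK mulrDr mulr1 -mulr2n.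
(* [b] lifts [2 x], and characters with [chi u = 1] send it to [2]. *)
- pose a := trepr x; pose b := a * (1 - u) + (1 + u).
  have xb : tpi b = x *+ 2.
    rewrite rmorphD rmorphM rmorphB rmorphD rmorph1 /= treprK.
    by rewrite [tpi u]telt_u opprK subrr addr0 mulrDr mulr1 -mulr2n.
  (* Invertibility is checked over [C], where the matrix becomes diagonal, yet it gives a rational
     inverse. *)
  have bu : regular_mx b \in unitmx.
    rewrite -(map_unitmx (ratr : {rmorphism rat -> C})) /= diagE.
    rewrite !unitmx_mul unitmx_inv Pu andbT /= unitmxE det_diag unitfE.
    apply/prodf_neq0 => i _.
    rewrite mxE !(gevalD, gevalM, gevalN) geval1 geval_elt.
    have [ui|ui] := eqVneq (chi i (abg_u G)) (-1).
      have := psix (Sub i (introT eqP ui)); rewrite -[x]treprK psiE /=.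
      rewrite ui subrr addr0 opprK -(mulr2n 1).
      by rewrite mulf_eq0 negb_or pnatr_eq0 => ->.
    have := gchar_u _ _ (chi i); rewrite (negPf ui) orbF => /eqP ->.
    by rewrite subrr mulr0 add0r -(mulr2n 1) pnatr_eq0.
  (* [v] is the row at 1 of the inverse matrix; its entries are the coefficients of the inverse of
     [b]. *)
  have [v vb] : exists v, v *m regular_mx b = row (enum_rank 1%g) 1%:M.
    exists (row (enum_rank 1%g) 1%:M *m invmx (regular_mx b)).
    by rewrite mulmxKV.
  pose c : grpRing rat G := [ffun g => v 0 (enum_rank g)] : {ffun G -> rat}.
  have cb : c * b = 1.
    apply: gcoefP => g; rewrite gcoefM -gelt1 gcoef_elt.
    have /rowP/(_ (enum_rank g)) := vb.
    rewrite !mxE (inj_eq enum_rank_inj) eq_sym => <-.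
    rewrite (reindex (fun k : 'I_#|G| => enum_val k)) /=; last first.
      by exists enum_rank => k _; rewrite ?enum_valK ?enum_rankK.
    by apply: eq_bigr => k _; rewrite [gcoef c _]ffunE enum_valK mxE enum_rankK.
  (* Since [tpi b] is [2 x], the inverse of [x] is twice the class of [c]. *)
  apply/unitrPr; exists (tpi c *+ 2).
  by rewrite mulrnAr -mulrnAl -xb -rmorphM mulrC cb rmorph1.
Qed.

End OddCharacters.

(** * Finite generation of [I] over the integers *)

Lemma gen_by_sum (K : Type) (V : nmodType) (act : K -> V -> V) (S : set V)
    (J : finType) (f : J -> V) :
  (forall j, gen_by act S (f j)) -> gen_by act S (\sum_j f j).
Proof.
move=> fS; elim/big_ind: _ => [|x y|j _]; last exact: fS.
(* [K] may be empty, so the empty family is a function on the empty type ['I_0]. *)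
- have no_ord (X : Type) (i : 'I_0) : X by case: i.
  by exists 0%N, (no_ord K), (no_ord V); split=> [[]|]; rewrite ?big_ord0.
- move=> [m [c [s [sS ->]]]] [n [d [t [tS ->]]]].
  exists (m + n)%N,
    (fun i => match split i with inl j => c j | inr j => d j end),
    (fun i => match split i with inl j => s j | inr j => t j end).
  split=> [i|]; first by case: split.
  rewrite big_split_ord; congr (_ + _); apply: eq_bigr => i _.
    by rewrite -[lshift n i]/(unsplit (inl i)) unsplitK.
  by rewrite -[rshift m i]/(unsplit (inr i)) unsplitK.
Qed.

Section FracIdealLattice.
Variables (G : abGroupU) (I : fracIdeal G).

Lemma fi_telt_closed g (x : fiType I) : telt rat g * fi_val x \in fi_set I.
Proof.
rewrite -ZGtoQG_telt; apply/mem_set/(@fi_act _ I).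
exact/set_mem/(valP x).
Qed.

Definition fi_telt g (x : fiType I) : fiType I :=
  exist (fun y => y \in fi_set I) _ (fi_telt_closed g x).

Lemma fi_teltE g x : fi_val (fi_telt g x) = telt rat g * fi_val x.
Proof. by []. Qed.

Lemma fi_val_inj : injective (@fi_val G I).
Proof. exact: val_inj. Qed.

Lemma fi_fin_gen_int :
  fin_gen (fun (k : int) (x : fiType I) => x *~ k) [set: fiType I].
Proof.
have [S Sfin IS] := @fi_fin_gen _ I.
pose T := (fun p : G * QG G => telt rat p.1 * p.2) @` ([set: G] `*` S).
have Tfin : finite_set T by apply/finite_image/finite_setX.
exists (@fi_val G I @^-1` T).
  by apply: finite_preimage => // x y _ _; exact: fi_val_inj.
apply/seteqP; split=> // x _.
have : fi_set I (fi_val x) by exact/set_mem/(valP x).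
rewrite IS => -[n [c [s [sS xE]]]].
(* Each generator is a one-term combination, hence lies in [I] and lifts to the subtype. *)
have /choice[s' s'E] i : exists z : fiType I, fi_val z = s i.
  have sI : s i \in fi_set I.
    apply/mem_set; rewrite IS; exists 1%N, (fun=> 1), (fun=> s i).
    by split=> //; rewrite big_ord1 /ZGact rmorph1 mul1r.
  by exists (exist (fun y => y \in fi_set I) _ sI).
have /choice[d dE] i := telt_span G (c i).
(* Each coefficient in [Z<G>] is expanded over [G], which moves the group elements onto the
   generators. *)
suff -> : x = \sum_i \sum_g fi_telt g (s' i) *~ d i g.
  apply: gen_by_sum => i; apply: gen_by_sum => g.
  exists 1%N, (fun=> d i g), (fun=> fi_telt g (s' i)); rewrite big_ord1.
  by split=> // _; exists (g, s i) => //=; rewrite fi_teltE s'E.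
apply: fi_val_inj; rewrite xE [RHS]raddf_sum; apply: eq_bigr => i _.
rewrite raddf_sum /ZGact dE rmorph_sum mulr_suml; apply: eq_bigr => g _.
by rewrite rmorphMz ZGtoQG_telt mulrzAl -s'E raddfMz.
Qed.

End FracIdealLattice.

Arguments fi_telt {G I}.

(** * Properties of [w] and the [G]-lattice structure on [I] *)

Theorem theorem8p2 (R : realType) (G : abGroupU) (I : fracIdeal G) (w : QG G)
    (hI : prod_module I (bar_set I) `<=` principal_module w)
    (hw : forall psi : {rmorphism QG G -> R[i]}, 0 < psi w) :
  [/\ tbar w = w,
      w \is a GRing.unit &
      exists (form : fiType I -> fiType I -> int)
             (act : G -> fiType I -> fiType I),
        [/\ forall x y, (form x y)%:~R = form_Iw w (fi_val x) (fi_val y),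
            forall g x, fi_val (act g x) = telt rat g * fi_val x &
            is_Glattice form act]].
Proof.
have [J [psi [psi_bar psi_tr psi_unit]]] := odd_characters R[i] G.
have psi_inj x : (forall j, psi j x = 0) -> x = 0.
  move=> psix0; apply: ttrace_nondegenerate => g.
  have := psi_tr (x * telt rat g).
  rewrite big1 ?mul0rn => [/eqP|j _]; last first.
    by rewrite rmorphM /= psix0 mul0r.
  rewrite mulrn_eq0 fmorph_eq0 => /orP[/eqP G0|/eqP //].
  (* [#|G|] is not 0, as [G] contains 1. *)
  by have := max_card (pred1 (1%g : G)); rewrite card1 G0.
have wbar : tbar w = w.
  apply/eqP; rewrite -subr_eq0; apply/eqP/psi_inj => j.
  by rewrite rmorphB /= psi_bar conj_Creal ?subrr // gtr0_real.
have wu : w \is a GRing.unit by apply: psi_unit => j; rewrite gt_eqF.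
(* [numq] loses nothing: the next claim shows that the rational form takes integral values. *)
pose form (x y : fiType I) := numq (form_Iw w (fi_val x) (fi_val y)).
have formE x y : (form x y)%:~R = form_Iw w (fi_val x) (fi_val y).
  (* A one-term sum places [x (bar y)] in the product module, so it equals [a w] with [a] in [Z<G>],
     and division by [w] leaves [a]. *)
  have /hI[a _ aw] : prod_module I (bar_set I) (fi_val x * tbar (fi_val y)).
    exists 1%N, (fun=> 1), (fun=> fi_val x * tbar (fi_val y)).
    split=> [_|]; last by rewrite big_ord1 /ZGact rmorph1 mul1r.
    exists (fi_val x), (tbar (fi_val y)); split=> //.
      exact/set_mem/(valP x).
    by exists (fi_val y) => //; exact/set_mem/(valP y).
  by rewrite /form /form_Iw -aw /ZGact mulrK // ttrace_ZGtoQG numq_int.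
have form_eq (x y x' y' : fiType I) :
    form_Iw w (fi_val x) (fi_val y) = form_Iw w (fi_val x') (fi_val y') ->
    form x y = form x' y'.
  by rewrite -!formE => /intr_inj.
have formC x y : form x y = form y x.
  (* As [bar w = w], the involution exchanges [x (bar y) / w] and [y (bar x) / w], and it preserves
     the trace. *)
  apply: form_eq; rewrite /form_Iw -ttrace_tbar !rmorphM /= rmorphV //= wbar.
  by rewrite tbarK [tbar _ * _]mulrC.
have formDl x y z : form (x + y) z = form x z + form y z.
  apply: (@intr_inj rat); rewrite rmorphD /= !formE /form_Iw.
  by rewrite [fi_val (x + y)]raddfD !mulrDl ttraceD.
have form_gt0 x : x != 0 -> 0 < form x x.
  (* The sign is read in [R[i]] after scaling by [#|G|], where the trace formula applies. *)
  move=> x0; rewrite -(ltr0z rat) formE -(ltr0q R[i]).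
  have G_gt0 : (0 < #|G|)%N by apply/card_gt0P; exists 1%g.
  rewrite -(pmulrn_lgt0 _ G_gt0) psi_tr pmulrn_lgt0 //.
  have psiE j : psi j (fi_val x * tbar (fi_val x) / w)
      = `|psi j (fi_val x)| ^+ 2 / psi j w.
    by rewrite !rmorphM /= rmorphV //= psi_bar normCK.
  have psi_ge0 j : 0 <= psi j (fi_val x * tbar (fi_val x) / w).
    by rewrite psiE divr_ge0 ?exprn_ge0 // ltW.
  (* A vanishing sum of nonnegative terms has all terms 0, so every [psi j] kills [x]. *)
  rewrite lt_def sumr_ge0 // andbT; apply: contra x0 => /eqP sum0.
  apply/eqP/fi_val_inj/psi_inj => j; apply/eqP.
  have /eqP : psi j (fi_val x * tbar (fi_val x) / w) = 0.
    by apply: (psumr_eq0P _ sum0).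
  by rewrite psiE mulf_eq0 invr_eq0 (gt_eqF (hw _)) orbF expf_eq0 normr_eq0.
split=> //; exists form, fi_telt; split=> //.
split.
- split=> //; first exact: fi_fin_gen_int.
  (* Additivity on the right follows from the left by symmetry. *)
  by move=> x y z; rewrite ![form x _]formC formDl.
- move=> g; split.
  + by move=> x y; apply: fi_val_inj; rewrite [RHS]raddfD /= -mulrDr -raddfD.
  + exists (fi_telt g^-1%g) => x; apply: fi_val_inj.
      by rewrite !fi_teltE mulrA -teltM mulVg telt1 mul1r.
    by rewrite !fi_teltE mulrA -teltM mulgV telt1 mul1r.
  (* The involution inverts [g], so the factors [g] and [g^-1] cancel. *)
  + move=> x y; apply: form_eq; rewrite /form_Iw !fi_teltE rmorphM /= tbar_telt.
    by rewrite mulrACA -teltM mulgV telt1 mul1r.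
- by move=> g h x; apply: fi_val_inj; rewrite !fi_teltE teltM mulrA.
- by move=> x; apply: fi_val_inj; rewrite fi_teltE telt_u mulN1r [RHS]raddfN.
Qed.
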